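(* Let $d\ge 0$ be an integer and let $r,s\in(-1,\infty)$ with $r\neq 0$ and $r+s=0$. Then $L,\left(L^*+\frac{r-d}{2}\right)^2$ is a Leonard pair on $\mathcal P_d(\mathbb R)$ (here $L^*+\frac{r-d}{2}$ means $L^*+\frac{r-d}{2}\cdot\mathrm{id}$).
   Context: Write $(x)_i=x(x+1)\cdots(x+i-1)$, with $(x)_0=1$. For $0\le i\le d$ put $\theta_i=(d-i)(d-i+r+s+1)$ and $\theta^*_i=i$; the $\theta_i$ are mutually distinct. Put $b^*_i=\frac{(d-i)(i-d-s)(2d-2i+r+s+2)_i}{(2d-2i+r+s)_{i+1}}$ for $0\le i\le d-1$, $c^*_i=\frac{i(i-d-r-1)(d-i+r+s+1)_{d-i}}{(d-i+r+s+2)_{d-i+1}}$ for $1\le i\le d$, $b^*_d=c^*_0=0$, and $a^*_i=\theta^*_0-b^*_i-c^*_i$ for $0\le i\le d$. Let $\mathcal P_d(\mathbb R)$ be the real vector space of polynomials in $x$ of degree at most $d$; each element is determined by its values at $\theta_0,\dots,\theta_d$. Let $L,L^*$ be the linear maps on $\mathcal P_d(\mathbb R)$ defined by $(Lf)(\theta_i)=\theta_i f(\theta_i)$ and $(L^*f)(\theta_i)=b^*_i f(\theta_{i+1})+a^*_i f(\theta_i)+c^*_i f(\theta_{i-1})$ for $0\le i\le d$ (terms with coefficient $b^*_d$ or $c^*_0$ are omitted). A square matrix is tridiagonal if its nonzero entries lie on the diagonal, subdiagonal or superdiagonal; it is irreducible tridiagonal if moreover all subdiagonal and superdiagonal entries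 are nonzero. A Leonard pair on a nonzero finite-dimensional vector space $V$ is an ordered pair $A,A^*$ of linear maps $V\to V$ such that (1) there is an ordered basis of $V$ in which $A$ is diagonal and $A^*$ is irreducible tridiagonal, and (2) there is an ordered basis of $V$ in which $A^*$ is diagonal and $A$ is irreducible tridiagonal. *)

(* Defs.v *)
From HB Require Import structures.
From mathcomp Require Import all_boot all_order all_algebra.
From mathcomp Require Import reals.
Set Implicit Arguments. Unset Strict Implicit. Unset Printing Implicit Defensive.
Import Order.TTheory GRing.Theory Num.Theory.
Local Open Scope ring_scope.

Definition tridiag {K : nzRingType} (n : nat) (M : 'M[K]_n) : Prop :=
  forall i j : 'I_n, ((i : nat).+1 < j)%N \/ ((j : nat).+1 < i)%N -> M i j = 0.

Definition irred_tridiag {K : nzRingType} (n : nat) (M : 'M[K]_n) : Prop :=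
  tridiag M /\
  forall i j : 'I_n, ((i : nat).+1 = j \/ (j : nat).+1 = i) -> M i j != 0.

(* A linear map h of a finite-dimensional vector space V has matrix
   passmx.mxof e e h in the ordered basis e (MathComp's row-vector convention,
   i.e. the transpose of the column convention; diagonality and
   (irreducible) tridiagonality are invariant under transposition). *)
Definition LeonardPair {K : fieldType} (V : vectType K) (A As : 'End(V)) : Prop :=
  (0 < \dim {:V})%N /\
  (exists e : (\dim {:V}).-tuple V,
      basis_of fullv e /\ is_diag_mx (passmx.mxof e e A) /\ irred_tridiag (passmx.mxof e e As)) /\
  (exists e : (\dim {:V}).-tuple V,
      basis_of fullv e /\ is_diag_mx (passmx.mxof e e As) /\ irred_tridiag (passmx.mxof e e A)).

Section Data.
Variable R : realType.

Definition poch (x : R) (i : nat) : R := \prod_(k < i) (x + k%:R).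

Variables (d : nat) (r s : R).

Definition theta (i : nat) : R := (d - i)%:R * ((d - i)%:R + r + s + 1).
Definition thetas (i : nat) : R := i%:R.

Definition bs (i : nat) : R :=
  if (i < d)%N then
    (d - i)%:R * (i%:R - d%:R - s) * poch ((2 * d - 2 * i)%:R + r + s + 2) i
      / poch ((2 * d - 2 * i)%:R + r + s) i.+1
  else 0.

Definition cs (i : nat) : R :=
  if (0 < i)%N then
    i%:R * (i%:R - d%:R - r - 1) * poch ((d - i)%:R + r + s + 1) (d - i)
      / poch ((d - i)%:R + r + s + 2) (d - i).+1
  else 0.

Definition as_ (i : nat) : R := thetas 0 - bs i - cs i.

End Data.

(* Main.v *)
(* Put m = d - i, so that the nodes are theta = m (m + 1), and let X be the
   shifted map Ls + (r - d)/2.  When r + s = 0 the shift cancels every diagonal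
   coefficient of Ls except the one at m = 0, and (X f)(m) is a combination of
   f (m - 1) and f (m + 1), where f (-1) means f 0 because m (m + 1) is invariant
   under m |-> -1 - m.  The graph of X is therefore the path 0 - 1 - ... - d with
   a loop at 0, and walks of length 2 on it move along the path
   ... 4, 2, 0, 1, 3, 5 ...; in the Lagrange basis listed in that order X^2 is
   irreducible tridiagonal.  Conversely the dual Hahn polynomials diagonalise X
   with eigenvalues n + (r - d)/2, hence X^2, and their three-term recurrence
   makes L irreducible tridiagonal. *)
Require Import Defs.
From HB Require Import structures.
From mathcomp Require Import all_boot all_order all_algebra.
From mathcomp Require Import reals.
From mathcomp Require Import ring lra zify.
Import Order.TTheory GRing.Theory Num.Theory.
Local Open Scope ring_scope.

Set Implicit Arguments.
Unset Strict Implicit.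

(** * Coordinates in a basis, and freeness of eigenvectors *)

Section LinearAlgebra.
Variables (K : fieldType) (V : vectType K).

Lemma coord_free_nat (N : nat) (X : N.-tuple V) (j : 'I_N) (i : nat) :
  free X -> coord X j X`_i = (i == j)%:R.
Proof.
move=> Xfree; have [iN|Ni] := ltnP i N; last first.
  rewrite nth_default ?size_tuple // linear0.
  by rewrite gtn_eqF // (leq_trans (ltn_ord j)).
exact: (coord_free (Ordinal iN)).
Qed.

(** The length [N] is kept apart from [\dim {:V}] because the bases used later have length [d.+1],
    equal to the dimension only by a lemma. *)
Lemma exists_diag_irred_tridiag (A B : 'End(V)) (N : nat) (X : N.-tuple V) :
  N = \dim {:V} -> basis_of fullv X ->
  (forall i j : 'I_N, i != j -> coord X j (A X`_i) = 0) ->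
  irred_tridiag (\matrix_(i < N, j < N) coord X j (B X`_i)) ->
  exists e : (\dim {:V}).-tuple V, basis_of fullv e /\
    is_diag_mx (passmx.mxof e e A) /\ irred_tridiag (passmx.mxof e e B).
Proof.
move=> eqN; subst N => Xb Adiag Btri.
have mxofE h : passmx.mxof X X h = \matrix_(i, j) coord X j (h X`_i).
  by apply/matrixP => i j; rewrite !mxE /= passmx.vecof_delta.
exists X; split=> //; rewrite !mxofE; split=> //.
by apply/is_diag_mxP => i j ij; rewrite mxE Adiag.
Qed.

Lemma free_eigenvectors (A : 'End(V)) (a : nat -> K) (v : nat -> V) (n : nat) :
  {in gtn n &, injective a} ->
  (forall i, (i < n)%N -> A (v i) = a i *: v i) ->
  (forall i, (i < n)%N -> v i != 0) ->
  free [tuple v i | i < n].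
Proof.
move=> a_inj Av v0; apply/freeP => c sum0.
have nthv (i : 'I_n) : [tuple v i | i < n]`_i = v i.
  by rewrite -tnth_nth tnth_mktuple.
have {nthv sum0} : \sum_(i < n) c i *: v i = 0.
  by rewrite -[RHS]sum0; apply: eq_bigr => i _; rewrite nthv.
elim: n => [|n IHn] in a_inj Av v0 c *; first by move=> _ [].
rewrite big_ord_recr /= => sum0.
(* Applying [A - a n] to the relation kills its last term and scales the others by the nonzero
   [a i - a n]. *)
have sumA : \sum_(i < n) (c (widen_ord (leqnSn n) i) * (a i - a n)) *: v i = 0.
  have := congr1 (fun u => A u - a n *: u) sum0.
  rewrite linear0 scaler0 subr0 linearD linearZ /= Av // scalerDr opprD.
  rewrite addrACA !scalerA [a n * _]mulrC subrr addr0 linear_sum scaler_sumr.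
  rewrite -sumrB => E; rewrite -[RHS]E; apply: eq_bigr => i _; rewrite linearZ /=.
  by rewrite Av ?ltnS 1?ltnW // !scalerA -scalerBl mulrBr [a n * _]mulrC.
have cn i : c (widen_ord (leqnSn n) i) = 0.
  have /eqP : c (widen_ord (leqnSn n) i) * (a i - a n) = 0.
    apply: (IHn _ _ _ (fun j : 'I_n =>
      c (widen_ord (leqnSn n) j) * (a j - a n))) => //.
    - by move=> x y xn yn; apply: a_inj; rewrite inE ltnS ltnW.
    - by move=> k kn; rewrite Av // ltnW.
    - by move=> k kn; rewrite v0 // ltnW.
  rewrite mulf_eq0 => /orP[/eqP //|].
  rewrite subr_eq0 => /eqP/a_inj; rewrite !inE ltnSn ltnS ltnW // => /(_ isT isT) E.
  by move: (ltn_ord i); rewrite E ltnn.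
move: sum0; rewrite big1 => [|i _]; last by rewrite cn scale0r.
rewrite add0r => /eqP; rewrite scaler_eq0 (negPf (v0 _ _)) // orbF => /eqP c0 i.
have [ni|ni] := ltnP i n; last first.
  by rewrite -c0; congr c; apply: val_inj; apply/eqP; rewrite eqn_leq ni -ltnS ltn_ord.
by rewrite -(cn (Ordinal ni)); congr c; apply: val_inj.
Qed.

End LinearAlgebra.

(** * Pochhammer symbols *)

Section Poch.
Variable R : realType.

Lemma poch_recr (x : R) n : poch x n.+1 = poch x n * (x + n%:R).
Proof. exact: big_ord_recr. Qed.

Lemma poch_recl (x : R) n : poch x n.+1 = x * poch (x + 1) n.
Proof.
rewrite /poch big_ord_recl addr0; congr (_ * _); apply: eq_bigr => i _.
by rewrite /= /bump natrD addrA.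
Qed.

Lemma poch_gt0 (x : R) n : 0 < x -> 0 < poch x n.
Proof. by move=> x0; apply: prodr_gt0 => i _; rewrite ltr_wpDr. Qed.

End Poch.

(** * The coefficients of the shifted map at the nodes [m (m + 1)] *)

Section DualHahn.
Variables (R : realType) (d : nat) (r : R).

Definition node (m : nat) : R := m%:R * (m%:R + 1).
(** Closed forms of [bs] (for [m > 0]) and [cs] at index [d - m] when [s = - r]. The substitution
    [m |-> -1 - m] exchanges [down] and [up]; [down 0] is the weight of the loop. *)
Definition down (m : nat) : R :=
  (r - m%:R) * (m%:R + d%:R + 1) / (2 * (2 * m%:R + 1)).
Definition up (m : nat) : R :=
  (m%:R - d%:R) * (m%:R + r + 1) / (2 * (2 * m%:R + 1)).
Definition shift : R := (r - d%:R) / 2.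

Lemma node_inj : injective node.
Proof.
move=> m n /eqP; rewrite -subr_eq0 /node.
have -> : m%:R * (m%:R + 1) - n%:R * (n%:R + 1) = (m%:R - n%:R) * (m + n).+1%:R :> R.
  by rewrite -addn1 !natrD; ring.
by rewrite mulf_eq0 pnatr_eq0 orbF subr_eq0 eqr_nat => /eqP.
Qed.

(* Truncated subtraction makes [node m.-1] the correct value [(m - 1) m] at
   [m = 0] as well. *)
Lemma node_pred (m : nat) : node m.-1 = (m%:R - 1) * m%:R.
Proof. by case: m => [|m]; rewrite /node /= ?mul0r ?mulr0 // -addn1 natrD; ring. Qed.

Lemma dbl1_neq0 (m : nat) : 2 * m%:R + 1 != 0 :> R.
Proof. by rewrite gt_eqF // ltr_wpDl // mulr_ge0. Qed.

Lemma thetaE (m : nat) : (m <= d)%N -> theta d r (- r) (d - m) = node m.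
Proof. by move=> md; rewrite /theta subKn // addrK. Qed.

Lemma bsE (m : nat) : (m <= d)%N ->
  bs d r (- r) (d - m) = if m == 0%N then 0 else down m.
Proof.
move=> md; rewrite /bs; case: (posnP m) => [->|m0]; first by rewrite subn0 ltnn.
rewrite ifT; last by lia.
set i := (d - m)%N.
have -> : (d - i)%N = m by rewrite /i subKn.
have -> : (2 * d - 2 * i = m * 2)%N by rewrite /i; lia.
have -> : i%:R = d%:R - m%:R :> R by rewrite /i natrB.
rewrite natrM !addrK.
have m0' : 0 < m%:R :> R by rewrite ltr0n.
set x : R := m%:R * 2; have x0 : 0 < x by rewrite mulr_gt0.
(* Both symbols in [bs] sit inside [poch x i.+2]: removing the first two factors leaves the
   numerator [Q], removing the last one leaves the denominator [P]. *)
have := poch_gt0 i.+1 x0; have := poch_recr x i.+1.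
rewrite poch_recl poch_recl -addrA -[1 + 1]/(2 : R).
have -> : i.+1%:R = d%:R - m%:R + 1 :> R by rewrite -addn1 natrD /i natrB.
set P := poch x _; set Q := poch _ _ => PQ P0.
have -> : Q = P * (x + (d%:R - m%:R + 1)) / (x * (x + 1)).
  by rewrite -PQ; field; lra.
rewrite /down /x; field; rewrite /x in x0 *; lra.
Qed.

Lemma csE (m : nat) : (m <= d)%N -> cs d r (- r) (d - m) = up m.
Proof.
move=> md; rewrite /cs; case: (ltnP 0 (d - m)) => [_|dm]; last first.
  have -> : m = d by lia.
  by rewrite /up subrr !mul0r.
rewrite subKn // natrB // !addrK.
set x : R := m%:R + 1; have x0 : 0 < x by rewrite ltr_wpDl.
have -> : m%:R + 2 = x + 1 by rewrite /x; ring.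
have x10 : 0 < x + 1 by rewrite addr_gt0.
have := poch_gt0 m.+1 x10; have := poch_recl x m.+1.
rewrite poch_recr poch_recr.
have -> : m.+1%:R = x by rewrite -addn1 natrD.
set P := poch (x + 1) _; set Q := poch _ _ => QP P0.
have -> : P = Q * (x + m%:R) * (x + x) / x by rewrite QP; field; lra.
have Q0 : 0 < Q by apply: poch_gt0.
have mm : 0 <= m%:R :> R by [].
rewrite /up /x; rewrite /x in x0; field; lra.
Qed.

(** Holds because [down m + up m = shift]; at [m = 0] the coefficient [bs] vanishes, so [down 0] is
    left over. *)
Lemma asE (m : nat) : (m <= d)%N ->
  as_ d r (- r) (d - m) + shift = if m == 0%N then down 0 else 0.
Proof.
move=> md; rewrite /as_ bsE // csE // /thetas /up /down /shift.
have := dbl1_neq0 m; case: (m =P 0%N) => [->|_] H; field => //.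
Qed.

(** At [m = 0] the first factor is [r] itself: [r != 0] keeps the loop at 0. *)
Lemma down_neq0 (m : nat) : r != 0 -> r < 1 -> down m != 0.
Proof.
move=> r0 r1; rewrite /down mulf_neq0 ?invr_neq0 ?mulf_neq0 ?dbl1_neq0 ?pnatr_eq0 //.
  case: m => [|m]; first by rewrite subr0.
  by rewrite lt_eqF // subr_lt0 (lt_le_trans r1) // ler1n.
by rewrite gt_eqF // ltr_wpDl // addr_ge0.
Qed.

Lemma up_neq0 (m : nat) : -1 < r -> (m < d)%N -> up m != 0.
Proof.
move=> r0 md; rewrite /up mulf_neq0 ?invr_neq0 ?mulf_neq0 ?dbl1_neq0 ?pnatr_eq0 //.
  by rewrite subr_eq0 eqr_nat ltn_eqF.
have : 0 <= m%:R :> R by [].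
by move=> ?; rewrite gt_eqF //; lra.
Qed.

(** * The Newton basis on the nodes *)

Definition newton (k : nat) (z : R) : R := \prod_(j < k) (z - node j).

Lemma newtonS k z : newton k.+1 z = newton k z * (z - node k).
Proof. exact: big_ord_recr. Qed.

(** Since [y (y + 1) - node j = (y - j) (y + j + 1)], moving [y] by one shifts both products and all
    but a few factors agree. *)
Lemma newton_succ k y :
  newton k.+1 ((y + 1) * (y + 2)) =
  newton k (y * (y + 1)) * ((y + k%:R + 1) * (y + k%:R + 2)).
Proof.
elim: k => [|k IHk]; first by rewrite newtonS /newton !big_ord0 /node; ring.
rewrite newtonS IHk newtonS /node -(addn1 k) natrD; ring.
Qed.

Lemma newton_pred k y :
  newton k.+1 ((y - 1) * y) =
  newton k (y * (y + 1)) * ((y - k%:R) * (y - k%:R - 1)).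
Proof.
(* The reflection [y |-> -1 - y] fixes [y (y + 1)] and turns a step up into a step down. *)
have := newton_succ k (- y - 1).
have -> : (- y - 1 + 1) * (- y - 1 + 2) = (y - 1) * y by ring.
have -> : (- y - 1) * (- y - 1 + 1) = y * (y + 1) by ring.
by move=> ->; ring.
Qed.

Lemma newton_node_eq0 k m : (m < k)%N -> newton k (node m) = 0.
Proof. by move=> mk; rewrite /newton (bigD1 (Ordinal mk)) //= subrr mul0r. Qed.

Definition phi (k : nat) : R := (k%:R - d%:R - 1) * (k%:R + r).

(** The difference operator is bidiagonal in the Newton basis, which reveals its eigenvalues
    [k + shift]. For [k > 0], each Newton value at [m] and its neighbours is a multiple of
    [newton k.-1 (node m)], leaving a rational identity. *)
Lemma newton_bidiag k m :
  down m * newton k (node m.-1) + up m * newton k (node m.+1) =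
  (k%:R + shift) * newton k (node m) + k%:R * phi k * newton k.-1 (node m).
Proof.
have -> : node m.+1 = (m%:R + 1) * (m%:R + 2) by rewrite /node -addn1 natrD; ring.
rewrite node_pred; have m0 := dbl1_neq0 m; case: k => [|k].
  by rewrite /newton !big_ord0 /down /up /shift; field.
rewrite newton_succ newton_pred newtonS /= -/(node m).
by rewrite /node -(addn1 k) natrD /phi /down /up /shift natrD; field.
Qed.

(** * Dual Hahn polynomials: difference equation and recurrence *)

Definition weight (k : nat) : R := \prod_(j < k) (phi j.+1)^-1.

Lemma phi_neq0 k : -1 < r -> (0 < k <= d)%N -> phi k != 0.
Proof.
move=> r1 /andP[k0 kd].
have : k%:R <= d%:R :> R by rewrite ler_nat.
have : 1 <= k%:R :> R by rewrite ler1n.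
by move=> ? ?; rewrite /phi mulf_neq0 //; [rewrite lt_eqF //|rewrite gt_eqF //]; lra.
Qed.

Lemma weightS k : -1 < r -> (k < d)%N -> phi k.+1 * weight k.+1 = weight k.
Proof.
move=> r1 kd; rewrite /weight big_ord_recr /= mulrCA mulfV ?mulr1 //.
by rewrite phi_neq0.
Qed.

(** For [n <= d], at [z = m (m + 1)] this is the hypergeometric sum 3F2(-n, -m, m + 1; r + 1, -d;
    1). *)
Definition hahn (n : nat) (z : R) : R :=
  \sum_(k < d.+1) 'C(n, k)%:R * (weight k * newton k z).

Lemma bin_raise (n k : nat) :
  k%:R * 'C(n, k)%:R + k.+1%:R * 'C(n, k.+1)%:R = n%:R * 'C(n, k)%:R :> R.
Proof.
rewrite -!natrM mul_bin_left -natrD -mulnDl.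
by have [kn|nk] := leqP k n; [rewrite subnKC|rewrite bin_small ?muln0].
Qed.

Lemma hahn_difference (n m : nat) : -1 < r -> (n <= d)%N ->
  down m * hahn n (node m.-1) + up m * hahn n (node m.+1) =
  (n%:R + shift) * hahn n (node m).
Proof.
move=> r1 nd; rewrite /hahn.
transitivity (\sum_(k < d.+1) 'C(n, k)%:R * (k%:R + shift) * (weight k * newton k (node m)) +
   \sum_(k < d.+1) 'C(n, k)%:R * k%:R * (phi k * weight k * newton k.-1 (node m))).
  rewrite !mulr_sumr -!big_split /=; apply: eq_bigr => k _.
  transitivity ('C(n, k)%:R * weight k *
    (down m * newton k (node m.-1) + up m * newton k (node m.+1))); first by ring.
  by rewrite newton_bidiag; ring.
rewrite [X in _ + X]big_ord_recl mulr0 mul0r add0r.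
have -> : \sum_(k < d) 'C(n, lift ord0 k)%:R * (lift ord0 k)%:R *
     (phi (lift ord0 k) * weight (lift ord0 k) * newton (lift ord0 k).-1 (node m)) =
   \sum_(k < d.+1) k.+1%:R * 'C(n, k.+1)%:R * (weight k * newton k (node m)).
  (* The added top term carries ['C(n, d.+1)], zero because [n <= d]. *)
  rewrite big_ord_recr /= [in RHS]bin_small // mulr0 mul0r addr0.
  by apply: eq_bigr => k _; rewrite /= /bump /= !add1n weightS // [_%:R * _%:R]mulrC.
rewrite -big_split mulr_sumr; apply: eq_bigr => k _ /=.
by rewrite -mulrDl [RHS]mulrA [in RHS]mulrDl -bin_raise; congr (_ * _); ring.
Qed.

Definition lower (n : nat) : R := n%:R * (n%:R + r - 1 - d%:R).

(** The three-term recurrence read off at [weight k * newton k]: multiplication by [z] sends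
    [newton k] to [newton k.+1 + node k * newton k], and [phi k] converts [weight k] into
    [weight k.-1]. *)
Lemma bin_recurrence (n k : nat) :
  (if k is k'.+1 then 'C(n, k')%:R else 0) * phi k + node k * 'C(n, k)%:R =
  phi n.+1 * 'C(n.+1, k)%:R - (phi n.+1 + lower n) * 'C(n, k)%:R
    + lower n * 'C(n.-1, k)%:R.
Proof.
case: k => [|k]; first by rewrite !bin0 /node; ring.
case: n => [|n] /=.
  by case: k => [|k]; rewrite ?bin0 ?bin1 ?(@bin_small _ _.+1) ?bin_small // /lower; ring.
rewrite (binS n.+1 k) [in _ * 'C(n, k.+1)%:R](_ : 'C(n, k.+1)%:R = 'C(n.+1, k.+1)%:R - 'C(n, k)%:R);
  last by rewrite binS natrD addrK.
have rel1 := bin_raise n.+1 k.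
have rel2 : n.+1%:R * 'C(n, k)%:R = k.+1%:R * 'C(n.+1, k.+1)%:R :> R.
  by rewrite -!natrM -mul_bin_diag.
rewrite natrD; move: rel1 rel2; rewrite /phi /lower /node -(addn1 n.+1) -!(addn1 k) -!(addn1 n) !natrD.
move: ('C(n, k)%:R : R) ('C(n + 1, k)%:R : R) ('C(n + 1, k + 1)%:R : R) => a b c rel1 rel2.
apply/eqP; rewrite -subr_eq0; apply/eqP.
(* The difference of the two sides as an explicit combination of [rel1] and [rel2]. *)
transitivity ((n%:R + 1 + k%:R + 1 + r - d%:R) * ((k%:R * b + (k%:R + 1) * c) - (n%:R + 1) * b)
  + (n%:R + r - d%:R) * ((n%:R + 1) * a - (k%:R + 1) * c)); first by ring.
by rewrite rel1 rel2 !subrr !mulr0 addr0.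
Qed.

Lemma hahn_recurrence (n m : nat) : -1 < r -> (m <= d)%N ->
  node m * hahn n (node m) =
  phi n.+1 * hahn n.+1 (node m) - (phi n.+1 + lower n) * hahn n (node m)
    + lower n * hahn n.-1 (node m).
Proof.
move=> r1 md; rewrite /hahn !mulr_sumr -sumrB -big_split /=.
transitivity (\sum_(k < d.+1) ((if k : nat is k'.+1 then 'C(n, k')%:R else 0) * phi k
    + node k * 'C(n, k)%:R) * (weight k * newton k (node m))); last first.
  by apply: eq_bigr => k _; rewrite bin_recurrence; ring.
under [RHS]eq_bigr do rewrite mulrDl.
rewrite big_split [X in _ = X + _]big_ord_recl /= !mul0r add0r.
transitivity (\sum_(k < d.+1) 'C(n, k)%:R * weight k * newton k.+1 (node m) +
   \sum_(k < d.+1) node k * 'C(n, k)%:R * (weight k * newton k (node m))).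
  rewrite -big_split; apply: eq_bigr => k _ /=; rewrite newtonS; ring.
(* Multiplication by [z] overflows into [newton d.+1], which vanishes at every node with
   [m <= d]. *)
congr (_ + _); rewrite big_ord_recr /= newton_node_eq0 ?ltnS // mulr0 addr0.
apply: eq_bigr => k _; rewrite /= /bump /= !add1n.
by rewrite -(weightS r1 (ltn_ord k)); ring.
Qed.

(** This normalisation shows that each [hahn_npoly n] is nonzero, hence a genuine eigenvector. *)
Lemma hahn0 (n : nat) : hahn n (node 0) = 1.
Proof.
rewrite /hahn big_ord_recl big1 => [|k _]; last by rewrite newton_node_eq0 ?mulr0.
by rewrite bin0 /weight /newton !big_ord0 !mulr1 addr0.
Qed.

Lemma lower_neq0 (n : nat) : r < 1 -> (0 < n <= d)%N -> lower n != 0.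
Proof.
move=> r1 /andP[n0 nd]; have : n%:R <= d%:R :> R by rewrite ler_nat.
by move=> ?; rewrite /lower mulf_neq0 ?pnatr_eq0 -?lt0n // lt_eqF //; lra.
Qed.

Definition hahn_npoly (n : nat) : {poly_d.+1 R} :=
  npolyp d.+1 (\sum_(k < d.+1) ('C(n, k)%:R * weight k) *: \prod_(j < k) ('X - (node j)%:P)).

Lemma horner_hahn_npoly n z : (val (hahn_npoly n)).[z] = hahn n z.
Proof.
rewrite [val _]npolypK.
  rewrite horner_sum; apply: eq_bigr => k _; rewrite hornerZ horner_prod -mulrA.
  by congr (_ * (_ * _)); apply: eq_bigr => j _; rewrite hornerXsubC.
apply: (leq_trans (size_sum _ _ _)); apply/bigmax_leqP => k _.
apply: (leq_trans (size_scale_leq _ _)).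
by rewrite size_prod_XsubC /index_enum -enumT size_enum_ord.
Qed.

Lemma eq_npoly_node (f g : {poly_d.+1 R}) :
  (forall m, (m <= d)%N -> (val f).[node m] = (val g).[node m]) -> f = g.
Proof.
move=> fg; have lfull := lagrange_full (n := d.+1) (x := node) (ltn0Sn d) node_inj.
rewrite (coord_basis lfull (memvf f)) (coord_basis lfull (memvf g)).
apply: eq_bigr => i _; rewrite !(lagrange_coords (ltn0Sn d) node_inj) fg // -ltnS; exact: ltn_ord.
Qed.

(* For [h = d./2] this lists [0, ..., d] as [..., 4, 2, 0, 1, 3, 5, ...]. *)
Definition zigzag (h p : nat) : nat :=
  if (p <= h)%N then (2 * (h - p))%N else (2 * (p - h)).-1.

Lemma zigzag_inj h : injective (zigzag h).
Proof. by move=> p q; rewrite /zigzag; do 2 case: leqP => ?; lia. Qed.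

Lemma zigzag_leq p : (p <= d)%N -> (zigzag d./2 p <= d)%N.
Proof. by move=> pd; rewrite /zigzag; case: (leqP p) => ?; lia. Qed.

Lemma zigzag_surj m : (m <= d)%N -> exists2 p, (p < d.+1)%N & zigzag d./2 p = m.
Proof.
move=> md; rewrite /zigzag; have [odd_m|even_m] := boolP (odd m).
  exists (d./2 + m./2).+1; first by lia.
  by case: (leqP _ d./2) => ?; lia.
exists (d./2 - m./2)%N; first by lia.
by case: (leqP _ d./2) => ?; lia.
Qed.

(** * The dual Hahn basis and the zigzag Lagrange basis *)

Variables L X : 'End({poly_d.+1 R}).
Hypothesis r_gt : -1 < r.
Hypothesis r_lt : r < 1.
Hypothesis LE : forall (f : {poly_d.+1 R}) m, (m <= d)%N ->
  (val (L f)).[node m] = node m * (val f).[node m].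
Hypothesis XE : forall (f : {poly_d.+1 R}) m, (m <= d)%N ->
  (val (X f)).[node m] = down m * (val f).[node m.-1] + up m * (val f).[node m.+1].

Lemma X_hahn_npoly n : (n <= d)%N ->
  X (hahn_npoly n) = (n%:R + shift) *: hahn_npoly n.
Proof.
move=> nd; apply: eq_npoly_node => m md.
by rewrite XE // hornerZ !horner_hahn_npoly hahn_difference.
Qed.

Lemma L_hahn_npoly n :
  L (hahn_npoly n) = phi n.+1 *: hahn_npoly n.+1
    - (phi n.+1 + lower n) *: hahn_npoly n + lower n *: hahn_npoly n.-1.
Proof.
apply: eq_npoly_node => m md.
by rewrite LE // !(hornerE, horner_hahn_npoly) hahn_recurrence.
Qed.

Lemma exists_diag_X2_irred_L : r != 0 ->
  exists e : (\dim {:{poly_d.+1 R}}).-tuple {poly_d.+1 R}, basis_of fullv e /\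
    is_diag_mx (passmx.mxof e e (X \o X)%VF) /\ irred_tridiag (passmx.mxof e e L).
Proof.
move=> r0; pose Y := [tuple hahn_npoly i | i < d.+1].
have YE n : (n <= d)%N -> Y`_n = hahn_npoly n.
  by move=> nd; rewrite -(tnth_nth _ Y (Ordinal (nd : n < d.+1)%N)) tnth_mktuple.
have Yfree : free Y.
  (* Freeness is taken from [X] rather than its square, as the [n + shift] are plainly distinct. *)
  apply: (free_eigenvectors (A := X) (a := fun n => n%:R + shift)).
  - by move=> m n _ _ /addIr/eqP; rewrite eqr_nat => /eqP.
  - by move=> n; apply: X_hahn_npoly.
  move=> n _; apply/eqP => h0; have /eqP := hahn0 n.
  by rewrite -horner_hahn_npoly h0 horner0 eq_sym oner_eq0.
have YL (i j : 'I_d.+1) : coord Y j (L Y`_i) =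
    phi i.+1 * (i.+1 == j)%:R - (phi i.+1 + lower i) * (i == j :> nat)%:R
    + lower i * (i.-1 == j)%:R.
  have id' : (i <= d)%N by rewrite -ltnS.
  rewrite YE // L_hahn_npoly -(YE i) // -(YE i.-1) ?(leq_trans (leq_pred _)) //.
  (* For [i = d] the entry of [Y] is out of range and defaults to 0, but [phi d.+1 = 0] makes both
     sides vanish. *)
  have -> : phi i.+1 *: hahn_npoly i.+1 = phi i.+1 *: Y`_i.+1.
    have [lt_id|le_di] := ltnP i d; first by rewrite YE.
    have -> : nat_of_ord i = d by lia.
    have -> : phi d.+1 = 0 by rewrite /phi -(addn1 d) natrD; ring.
    by rewrite !scale0r.
  by rewrite linearD linearB /= !linearZ /= !coord_free_nat.
apply: (exists_diag_irred_tridiag (X := Y)).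
- by rewrite dim_polyn.
- by rewrite basisEfree Yfree subvf size_tuple dim_polyn /=.
- move=> i j ij; rewrite YE -1?ltnS // comp_lfunE X_hahn_npoly -1?ltnS //.
  rewrite linearZ /= X_hahn_npoly -1?ltnS // -YE -1?ltnS // !linearZ /=.
  by rewrite coord_free_nat // (negPf (ij : i != j :> nat)) !mulr0.
split=> i j ij; rewrite mxE YL.
  have [/negPf-> /negPf-> /negPf->] :
      [/\ i.+1 != j, nat_of_ord i != j & i.-1 != j] by split; lia.
  by rewrite !mulr0 subr0 addr0.
have jd := ltn_ord j; have id' := ltn_ord i; case: ij => ij.
  have [/negPf-> /negPf->] : nat_of_ord i != j /\ i.-1 != j by split; lia.
  by rewrite ij eqxx !mulr0 mulr1 subr0 addr0 -ij phi_neq0 //; lia.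
have [/negPf-> /negPf->] : i.+1 != j /\ nat_of_ord i != j by split; lia.
by rewrite -ij eqxx !mulr0 mulr1 subr0 add0r lower_neq0 //; lia.
Qed.

Lemma exists_diag_L_irred_X2 : r != 0 ->
  exists e : (\dim {:{poly_d.+1 R}}).-tuple {poly_d.+1 R}, basis_of fullv e /\
    is_diag_mx (passmx.mxof e e L) /\ irred_tridiag (passmx.mxof e e (X \o X)%VF).
Proof.
move=> r0; pose x p := node (zigzag d./2 p).
have x_inj : injective x by move=> p q /node_inj/zigzag_inj.
pose Y := lagrange d.+1 x; pose z p := zigzag d./2 p.
have zd (j : 'I_d.+1) : (z j <= d)%N by rewrite zigzag_leq // -ltnS.
have coordE f (j : 'I_d.+1) : coord Y j f = (val f).[node (z j)].
  exact: lagrange_coords.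
have YE (i : 'I_d.+1) m : (m <= d)%N -> (val Y`_i).[node m] = (z i == m)%:R.
  case/zigzag_surj => p pd <-; rewrite nth_lagrange.
  by rewrite (lagrange_sample (ltn0Sn d) x_inj i (Ordinal pd)) /z (inj_eq (@zigzag_inj _)).
have up_d : up d = 0 by rewrite /up subrr !mul0r.
have XYE (i : 'I_d.+1) m : (m <= d)%N -> (val (X Y`_i)).[node m] =
    down m * (z i == m.-1)%:R + up m * (z i == m.+1)%:R.
  move=> md; rewrite XE // YE ?(leq_trans (leq_pred _)) //; congr (_ + _).
  have [lt_md|dm] := ltnP m d; first by rewrite YE.
  by rewrite (_ : m = d) ?up_d ?mul0r //; lia.
(* The four walks of length 2 from [m]; truncated predecessors encode passages through the loop at
   0. *)
have X2YE (i : 'I_d.+1) m : (m <= d)%N -> (val (X (X Y`_i))).[node m] =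
    down m * (down m.-1 * (z i == m.-2)%:R + up m.-1 * (z i == m.-1.+1)%:R)
    + up m * (down m.+1 * (z i == m)%:R + up m.+1 * (z i == m.+2)%:R).
  move=> md; rewrite XE // XYE ?(leq_trans (leq_pred _)) //; congr (_ + _).
  have [lt_md|dm] := ltnP m d; first by rewrite XYE.
  by rewrite (_ : m = d) ?up_d ?mul0r //; lia.
apply: (exists_diag_irred_tridiag (X := Y)).
- by rewrite dim_polyn.
- exact: lagrange_full.
- move=> i j ij; rewrite coordE LE // YE // (inj_eq (@zigzag_inj _)).
  by rewrite (negPf (ij : i != j :> nat)) mulr0.
split=> i j ij; rewrite mxE coordE comp_lfunE X2YE //.
  have zij : [/\ z i != (z j).-2, z i != (z j).-1.+1, z i != z j & z i != (z j).+2].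
    by move: ij; rewrite /z /zigzag; split; do 2 case: leqP => ?; lia.
  by case: zij => /negPf-> /negPf-> /negPf-> /negPf->; rewrite !(mulr0, addr0).
(* The middle case includes the walk 1, 0, 0, as [1.-2 = 0]; the last case is the walk 0, 0, 1. In
   each case exactly one walk contributes. *)
have : [\/ z i = (z j).+2, (0 < z j)%N /\ z i = (z j).-2 | z j = 0%N /\ z i = 1%N].
  rewrite /z /zigzag; case: ij => ij; case: (leqP i) => ?; case: (leqP j) => ?;
  by [apply: Or31; lia | apply: Or32; lia | apply: Or33; lia].
move: (zd i); move: (z i) (z j) => a b /[swap] -[->|[b0 ->]|[-> ->]] ad.
- have [/negPf-> /negPf-> /negPf->] : [/\ b.+2 != b.-2, b.+2 != b.-1.+1 & b.+2 != b].
    by split; lia.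
  by rewrite eqxx !(mulr0, mulr1, add0r) mulf_neq0 // up_neq0 //; apply: ltnW.
- have [/negPf-> /negPf-> /negPf->] : [/\ b.-2 != b.-1.+1, b.-2 != b & b.-2 != b.+2].
    by split; lia.
  by rewrite eqxx !(mulr0, mulr1, addr0) mulf_neq0 ?down_neq0.
by rewrite /= !(mulr0, mulr1, add0r, addr0) mulf_neq0 ?down_neq0 ?up_neq0.
Qed.

End DualHahn.

(** * Translation from the indices [i] to the nodes [m = d - i] *)

Unset Implicit Arguments.

Theorem theorem1p3 (R : realType) (d : nat) (r s : R)
  (hr : -1 < r) (hs : -1 < s) (hr0 : r != 0) (hrs : r + s = 0)
  (L Ls : 'End({poly_d.+1 R}))
  (hL : forall (f : {poly_d.+1 R}) (i : nat), (i <= d)%N ->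
          (val (L f)).[theta d r s i] = theta d r s i * (val f).[theta d r s i])
  (hLs : forall (f : {poly_d.+1 R}) (i : nat), (i <= d)%N ->
          (val (Ls f)).[theta d r s i] =
            bs d r s i * (val f).[theta d r s i.+1]
            + as_ d r s i * (val f).[theta d r s i]
            + cs d r s i * (val f).[theta d r s i.-1]) :
  LeonardPair L
    ((Ls + ((r - d%:R) / 2) *: \1) \o (Ls + ((r - d%:R) / 2) *: \1))%VF.
Proof.
have sE : s = - r by lra.
subst s; have r_lt : r < 1 by lra.
have LE f m : (m <= d)%N -> (val (L f)).[node R m] = node R m * (val f).[node R m].
  by move=> md; rewrite -(thetaE r md) hL ?leq_subr.
set X := (Ls + _)%VF.
have XE f m : (m <= d)%N -> (val (X f)).[node R m] =
    down d r m * (val f).[node R m.-1] + up d r m * (val f).[node R m.+1].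
  move=> md; rewrite add_lfunE scale_lfunE id_lfunE hornerD hornerZ.
  rewrite -[in LHS](thetaE r md) hLs ?leq_subr // thetaE // csE // bsE //.
  transitivity ((if m == 0%N then 0 else down d r m) * (val f).[theta d r (- r) (d - m).+1]
    + (as_ d r (- r) (d - m) + shift d r) * (val f).[node R m]
    + up d r m * (val f).[theta d r (- r) (d - m).-1]); first by rewrite /shift; ring.
  rewrite asE //; congr (_ + _).
    (* At [m = 0] the surviving diagonal entry supplies the [down 0] term, since [node 0.-1] is
       [node 0]. *)
    case: (posnP m) => [->|m0]; first by rewrite mul0r add0r.
    rewrite mul0r addr0 -(@thetaE R d r m.-1) ?(leq_trans (leq_pred _)) //.
    by congr (_ * _.[theta _ _ _ _]); lia.
  (* At [m = d] the truncated index gives [theta] at 0, not [node d.+1]; the coefficient [up d = 0]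
     hides the mismatch. *)
  have [lt_md|dm] := ltnP m d.
    rewrite -(@thetaE R d r m.+1) //.
    by congr (_ * _.[theta _ _ _ _]); lia.
  have -> : m = d by lia.
  by rewrite /up subrr !mul0r.
split; first by rewrite dim_polyn.
by split; [apply: exists_diag_L_irred_X2 XE _|apply: exists_diag_X2_irred_L XE _].
Qed.
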